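(* Let $\mathcal{D}$ be the mirror Heisenberg-Virasoro algebra over $\mathbb{C}$. Every local derivation of $\mathcal{D}$ is a derivation of $\mathcal{D}$.
   Context: All vector spaces are over $\mathbb{C}$. The mirror Heisenberg-Virasoro algebra $\mathcal{D}$ is the complex Lie algebra with basis $\{L_m,\mathbf{c}\mid m\in\mathbb{Z}\}\cup\{I_r,\mathbf{l}\mid r\in\frac12+\mathbb{Z}\}$ and non-vanishing brackets $$[L_m,L_n]=(m-n)L_{m+n}+\delta_{m+n,0}\tfrac{m^3-m}{12}\mathbf{c},\quad [L_m,I_r]=-rI_{m+r},\quad [I_r,I_s]=r\delta_{r+s,0}\mathbf{l},$$ for $m,n\in\mathbb{Z}$, $r,s\in\frac12+\mathbb{Z}$ (so $\mathbf{c},\mathbf{l}$ are central). A local derivation of a Lie algebra $\mathfrak{g}$ is a linear map $f:\mathfrak{g}\to\mathfrak{g}$ such that for every $x\in\mathfrak{g}$ there exists a derivation $D_x$ of $\mathfrak{g}$ (depending on $x$) with $f(x)=D_x(x)$. *)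

(* Defs.v *)
From HB Require Import structures.
From mathcomp Require Import all_boot all_order all_algebra.
From mathcomp Require Import ring.
From mathcomp Require Import freeg.

Set Implicit Arguments.
Unset Strict Implicit.
Unset Printing Implicit Defensive.

Import Order.TTheory GRing.Theory Num.Theory.
Local Open Scope ring_scope.

Reserved Notation "[lie x , y ]" (at level 0, x at level 99, y at level 99,
  format "[lie  x ,  y ]").

HB.mixin Record Lmodule_isLieAlgebra (K : fieldType) V of GRing.Lmodule K V := {
  lie : V -> V -> V;
  lie_linearl : forall y, linear (lie^~ y);
  lie_linearr : forall x, linear (lie x);
  liexx : forall x, lie x x = 0;
  lie_jacobi : forall x y z,
    lie x (lie y z) + lie y (lie z x) + lie z (lie x y) = 0
}.

#[short(type="lieAlgType")]
HB.structure Definition LieAlgebra (K : fieldType) :=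
  { V of GRing.Lmodule K V & Lmodule_isLieAlgebra K V }.

Notation "[lie x , y ]" := (lie x y) : ring_scope.

Section Derivations.
Variables (K : fieldType) (g : lieAlgType K).

Definition derivation (D : {linear g -> g}) : Prop :=
  forall x y, D [lie x, y] = [lie D x, y] + [lie x, D y].

Definition local_derivation (f : {linear g -> g}) : Prop :=
  forall x, exists D : {linear g -> g}, derivation D /\ f x = D x.

End Derivations.

(* [BI k] indexes the basis vector I_r with r = k + 1/2, so that the integer
   index k runs over all half-integers r. *)
Inductive mhv_index := BL of int | BI of int | Bc | Bl.

Definition mhv_index_encode (b : mhv_index) : int + int + bool :=
  match b with
  | BL m => inl (inl m) | BI k => inl (inr k) | Bc => inr true | Bl => inr false
  end.

Definition mhv_index_decode (s : int + int + bool) : mhv_index :=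
  match s with
  | inl (inl m) => BL m | inl (inr k) => BI k
  | inr true => Bc | inr false => Bl
  end.

Lemma mhv_index_encodeK : cancel mhv_index_encode mhv_index_decode.
Proof. by case. Qed.

HB.instance Definition _ := Countable.copy mhv_index
  (can_type mhv_index_encodeK).

Lemma eqN_eq0 (K : numFieldType) (V : lmodType K) (v : V) : v = - v -> v = 0.
Proof.
move=> /eqP; rewrite -addr_eq0 -mulr2n -scaler_nat scaler_eq0 pnatr_eq0 /=.
by move/eqP.
Qed.

Lemma addr3ACA (V : zmodType) (a a' b b' c c' : V) :
  (a + a') + (b + b') + (c + c') = (a + b + c) + (a' + b' + c').
Proof. by rewrite (addrACA a) (addrACA (a + b)). Qed.

Lemma lincomb3_eq0 (K : fieldType) (V : lmodType K) (e f : V)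
    (c1 c2 c3 p1 p2 p3 q1 q2 q3 : K) :
  c1 * p1 + c2 * p2 + c3 * p3 = 0 -> c1 * q1 + c2 * q2 + c3 * q3 = 0 ->
  c1 *: (p1 *: e + q1 *: f) + c2 *: (p2 *: e + q2 *: f)
    + c3 *: (p3 *: e + q3 *: f) = 0.
Proof.
move=> p0 q0; rewrite !scalerDr !scalerA addr3ACA -!scalerDl p0 q0.
by rewrite !scale0r addr0.
Qed.

Lemma scale3_eq0 (K : fieldType) (V : lmodType K) (e : V) (c1 c2 c3 : K) :
  c1 + c2 + c3 = 0 -> c1 *: e + c2 *: e + c3 *: e = 0.
Proof. by move=> c0; rewrite -!scalerDl c0 scale0r. Qed.

Lemma lin_rearr (K : fieldType) (V : lmodType K) (a c : K)
    (u1 u2 u3 v1 v2 v3 : V) :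
  a *: u1 + v1 - (c *: (a *: u2 + v2) + (a *: u3 + v3)) =
  a *: (u1 - (c *: u2 + u3)) + (v1 - (c *: v2 + v3)).
Proof.
rewrite scalerBr !scalerDr !scalerA (mulrC a c) (addrACA (_ *: u2)).
by rewrite opprD addrACA.
Qed.

Section LinearExtension.
Variables (K : fieldType) (B : choiceType) (V : lmodType K).

Lemma fglift_linear (h : B -> V) : linear (fglift h : {freeg B / K} -> V).
Proof.
pose F := GRing.isAdditive.Build _ _ _ (lift_is_additive h).
pose h' : {additive {freeg B / K} -> V} := HB.pack (fglift h) F.
have hE : fglift h = h' by [].
move=> a x y; rewrite hE raddfD; congr (_ + _).
rewrite -{2}(freeg_sumE x) [a *: x]/(fgscale a x) !raddf_sum.
by apply: eq_bigr => b _; rewrite -hE !liftU /= scalerA.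
Qed.

Lemma freeg_linear_eq0 (f : {freeg B / K} -> V) :
  linear f -> (forall b, f << b >> = 0) -> forall x, f x = 0.
Proof.
move=> lf f0 x; pose F := GRing.isLinear.Build K _ V _ f lf.
pose f' : {linear {freeg B / K} -> V} := HB.pack f F.
rewrite -[f]/(f' : _ -> _) -(freeg_sumE x) raddf_sum big1 // => b _.
have -> : << coeff b x *g b >> = coeff b x *: (<< b >> : {freeg B / K}).
  by apply/eqP/freeg_eqP => k; rewrite coeffZ !coeffU mul1r.
by rewrite /f' /= (scalable_linear lf) /= f0 scaler0.
Qed.

End LinearExtension.

Definition mhv (K : numFieldType) := {freeg mhv_index / K}.
HB.instance Definition _ (K : numFieldType) := GRing.Lmodule.on (mhv K).

Section MirrorHeisenbergVirasoro.
Variable K : numFieldType.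
Implicit Types (m n k j : int) (a b : mhv_index) (x y z : mhv K).

Definition mhvL m : mhv K := << BL m >>.
Definition mhvI k : mhv K := << BI k >>.
Definition mhvc : mhv K := << Bc >>.
Definition mhvl : mhv K := << Bl >>.

Definition halfint k : K := k%:~R + 2^-1.

(* The condition r + s = 0 for r = k + 1/2 and s = j + 1/2 reads
   k + j + 1 = 0. *)
Definition mhv_basis_lie a b : mhv K :=
  match a, b with
  | BL m, BL n => (m - n)%:~R *: mhvL (m + n)
      + (if m + n == 0 then (m%:~R ^+ 3 - m%:~R) / 12 else 0) *: mhvc
  | BL m, BI k => - halfint k *: mhvI (m + k)
  | BI k, BL m => halfint k *: mhvI (m + k)
  | BI k, BI j => (if k + j + 1 == 0 then halfint k else 0) *: mhvl
  | _, _ => 0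
  end.

(* [fglift h] is the linear extension of [h] from basis elements. *)
Definition mhv_lie x y : mhv K :=
  fglift (fun a => fglift (mhv_basis_lie a) y) x.

Lemma mhv_lieU a b : mhv_lie << a >> << b >> = mhv_basis_lie a b.
Proof. by rewrite /mhv_lie !liftU !scale1r. Qed.

Lemma mhv_lie_linearl y : linear (fun x => mhv_lie x y).
Proof. exact: fglift_linear. Qed.

Lemma mhv_lie_linearr x : linear (mhv_lie x).
Proof.
move=> c y z; apply/eqP; rewrite -subr_eq0; apply/eqP; move: x.
apply: freeg_linear_eq0 => [a u v|a].
  by rewrite !mhv_lie_linearl; apply: lin_rearr.
by rewrite /mhv_lie !liftU !scale1r fglift_linear subrr.
Qed.

HB.instance Definition _ x := GRing.isLinear.Build K (mhv K) (mhv K) _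
  (mhv_lie x) (mhv_lie_linearr x).

Lemma mhv_lieDr x y z : mhv_lie x (y + z) = mhv_lie x y + mhv_lie x z.
Proof. exact: raddfD. Qed.

Lemma mhv_lieZr c x y : mhv_lie x (c *: y) = c *: mhv_lie x y.
Proof. exact: linearZ. Qed.

Lemma mhv_lie0r x : mhv_lie x 0 = 0. Proof. exact: raddf0. Qed.

Lemma mhv_lieDl x y z : mhv_lie (x + y) z = mhv_lie x z + mhv_lie y z.
Proof. by have := mhv_lie_linearl z 1 x y; rewrite !scale1r. Qed.

Lemma mhv_lieZl c x z : mhv_lie (c *: x) z = c *: mhv_lie x z.
Proof. exact: (scalable_linear (mhv_lie_linearl z)). Qed.

Lemma mhv_basis_lieC a b : mhv_basis_lie a b = - mhv_basis_lie b a.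
Proof.
case: a b => [m|k||] [n|j||] //=; rewrite ?oppr0 ?scaleNr ?opprK //.
- rewrite opprD -!scaleNr (addrC n m); congr (_ *: _ + _ *: _).
    by rewrite -rmorphN opprB.
  case: eqP => [mn0|_]; last by rewrite oppr0.
  by rewrite -(addr0_eq mn0) rmorphN /=; ring.
- rewrite -scaleNr (addrC j k); congr (_ *: _).
  case: eqP => [kj0|_]; last by rewrite oppr0.
  have -> : j = - (k + 1) by apply/eqP; rewrite -subr_eq0 -kj0; apply/eqP; ring.
  by rewrite /halfint rmorphN rmorphD /=; field.
Qed.

Lemma mhv_lieC x y : mhv_lie x y = - mhv_lie y x.
Proof.
apply/eqP; rewrite -addr_eq0; apply/eqP; move: x.
apply: freeg_linear_eq0 => [c x z|a].
  by rewrite mhv_lie_linearl mhv_lie_linearr scalerDr addrACA.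
move: y; apply: freeg_linear_eq0 => [c y z|b].
  by rewrite mhv_lie_linearl mhv_lie_linearr scalerDr addrACA.
by rewrite !mhv_lieU mhv_basis_lieC addNr.
Qed.

Lemma mhv_liexx x : mhv_lie x x = 0.
Proof. by apply: eqN_eq0; exact: mhv_lieC. Qed.

Definition mhv_jac x y z := mhv_lie x (mhv_lie y z) +
  mhv_lie y (mhv_lie z x) + mhv_lie z (mhv_lie x y).

Lemma mhv_jacC x y z : mhv_jac x y z = mhv_jac y z x.
Proof. by rewrite /mhv_jac [RHS]addrC addrA. Qed.

Lemma mhv_jac_linear y z : linear (fun x => mhv_jac x y z).
Proof.
move=> c x t; rewrite /mhv_jac !(mhv_lieDl, mhv_lieZl, mhv_lieDr, mhv_lieZr).
by rewrite !scalerDr addr3ACA.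
Qed.

Lemma mhv_jacLLL m n k : mhv_jac (mhvL m) (mhvL n) (mhvL k) = 0.
Proof.
rewrite /mhv_jac !mhv_lieU /= !(mhv_lieDr, mhv_lieZr) !mhv_lieU /= !scaler0.
rewrite !addr0 (_ : n + (k + m) = m + (n + k)); last by ring.
rewrite (_ : k + (m + n) = m + (n + k)); last by ring.
apply: lincomb3_eq0; first by rewrite !(rmorphD, rmorphN) /=; ring.
case: eqP => [s0|_]; last by rewrite !mulr0 !addr0.
have -> : m = - (n + k) by rewrite -(addr0_eq s0) opprK.
by rewrite !(rmorphD, rmorphN) /=; ring.
Qed.

Lemma mhv_jacLLI m n k : mhv_jac (mhvL m) (mhvL n) (mhvI k) = 0.
Proof.
rewrite /mhv_jac !mhv_lieU /= !(mhv_lieDr, mhv_lieZr) !mhv_lieU /= !scaler0.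
have -> : mhvI (n + (m + k)) = mhvI (m + (n + k)) by rewrite addrCA.
have -> : mhvI (m + n + k) = mhvI (m + (n + k)) by rewrite addrA.
rewrite addr0 !scalerA; apply: scale3_eq0.
by rewrite /halfint !(rmorphD, rmorphN) /=; ring.
Qed.

Lemma mhv_jacLII m k j : mhv_jac (mhvL m) (mhvI k) (mhvI j) = 0.
Proof.
rewrite /mhv_jac !mhv_lieU /= !mhv_lieZr !mhv_lieU /= !scaler0 !scalerA.
rewrite -[X in X + _ + _](scale0r mhvl); apply: scale3_eq0.
rewrite (_ : j + (m + k) = k + (m + j)); last by ring.
case: ifP => _; last by rewrite !mulr0 !addr0.
by ring.
Qed.

Lemma mhv_jacIII i k j : mhv_jac (mhvI i) (mhvI k) (mhvI j) = 0.
Proof.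
by rewrite /mhv_jac !mhv_lieU /= !mhv_lieZr !mhv_lieU /= !scaler0 !addr0.
Qed.

Lemma mhv_lie_central a b : a = Bc \/ a = Bl -> mhv_lie << a >> << b >> = 0.
Proof. by rewrite mhv_lieU; case=> ->. Qed.

Lemma mhv_lie_centrall a x : a = Bc \/ a = Bl -> mhv_lie << a >> x = 0.
Proof.
move=> cenA; move: x; apply: freeg_linear_eq0 => [|b].
  exact: mhv_lie_linearr.
exact: mhv_lie_central.
Qed.

Lemma mhv_jac_central a y z : a = Bc \/ a = Bl -> mhv_jac << a >> y z = 0.
Proof.
move=> cenA; rewrite /mhv_jac (mhv_lieC z) !(mhv_lie_centrall _ cenA).
by rewrite oppr0 !mhv_lie0r !addr0.
Qed.

Lemma mhv_lie_jacobi x y z : mhv_lie x (mhv_lie y z) +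
  mhv_lie y (mhv_lie z x) + mhv_lie z (mhv_lie x y) = 0.
Proof.
rewrite -/(mhv_jac x y z); move: x.
apply: freeg_linear_eq0 => [|a]; first exact: mhv_jac_linear.
rewrite mhv_jacC; move: y.
apply: freeg_linear_eq0 => [|b]; first exact: mhv_jac_linear.
rewrite mhv_jacC; move: z.
apply: freeg_linear_eq0 => [|c]; first exact: mhv_jac_linear.
case: c => [m|i||]; try by apply: mhv_jac_central; auto.
  case: a => [n|k||]; rewrite mhv_jacC; try by apply: mhv_jac_central; auto.
    case: b => [p|j||]; rewrite mhv_jacC; try by apply: mhv_jac_central; auto.
      exact: mhv_jacLLL.
    by rewrite mhv_jacC; exact: mhv_jacLLI.
  case: b => [p|j||]; rewrite mhv_jacC; try by apply: mhv_jac_central; auto.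
    exact: mhv_jacLLI.
  by rewrite mhv_jacC; exact: mhv_jacLII.
case: a => [n|k||]; rewrite mhv_jacC; try by apply: mhv_jac_central; auto.
  case: b => [p|j||]; rewrite mhv_jacC; try by apply: mhv_jac_central; auto.
    by rewrite -mhv_jacC; exact: mhv_jacLLI.
  by rewrite -mhv_jacC; exact: mhv_jacLII.
case: b => [p|j||]; rewrite mhv_jacC; try by apply: mhv_jac_central; auto.
  exact: mhv_jacLII.
exact: mhv_jacIII.
Qed.

HB.instance Definition _ := Lmodule_isLieAlgebra.Build K (mhv K)
  mhv_lie_linearl mhv_lie_linearr mhv_liexx mhv_lie_jacobi.

Lemma lieLL m n : [lie mhvL m, mhvL n] = (m - n)%:~R *: mhvL (m + n)
  + (if m + n == 0 then (m%:~R ^+ 3 - m%:~R) / 12 else 0) *: mhvc.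
Proof. exact: mhv_lieU. Qed.

Lemma lieLI m k : [lie mhvL m, mhvI k] = - halfint k *: mhvI (m + k).
Proof. exact: mhv_lieU. Qed.

Lemma lieII k j :
  [lie mhvI k, mhvI j] = (if k + j + 1 == 0 then halfint k else 0) *: mhvl.
Proof. exact: mhv_lieU. Qed.

Lemma lie_c x : [lie mhvc, x] = 0.
Proof. by apply: mhv_lie_centrall; left. Qed.

Lemma lie_l x : [lie mhvl, x] = 0.
Proof. by apply: mhv_lie_centrall; right. Qed.

End MirrorHeisenbergVirasoro.

(* Main.v *)
Require Import Defs.
From HB Require Import structures.
From mathcomp Require Import all_boot all_order all_algebra.
From mathcomp Require Import reals complex.
From mathcomp Require Import ring zify freeg.

(** Why the theorem holds.  Read L_m as a vector field and I_r as a function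
    on the punctured line: put L_m = z^m T and I_r = z^r with T = z d/dz.  Up
    to central terms the bracket of (X, A) with (U, B), where X, U are the
    coefficients of T in Laurent polynomial vector fields and A, B are
    half-integral Laurent polynomials, is (X TU - U TX, X TB - U TA), up to a
    global sign.

    Every derivation is ad u + lam delta, where delta is the only outer
    derivation: it multiplies I_r by 1 and l by 2 ([derivationP]).  A local
    derivation f thus satisfies f x = [u, x] + lam delta x with u and lam
    depending on x ([pointwise_derivation]).  To exploit this, pair with linear
    functionals: a functional that kills [g, x] and delta x also kills f x
    ([pointwise_pairing]), and this costs one check per basis vector, with no
    equation to solve for u.  Good functionals come from the zeros of the
    vector field part X of x, since at a zero rho of X the values of [u, x]
    and of its derivative depend on u through U(rho) only.

    Subtract from f a combination of inner derivations and delta so that it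
    vanishes on one family of basis vectors after the other.
    - If f L_0 = 0, then f L_m = f (L_m - rho^m L_0) for all rho, and this
      field vanishes at rho.  The resulting identities hold for all nonzero
      rho, so they kill all coefficients of f L_m but one ([fL_diagonal]).
      The field L_1 + L_n - 2 L_0, which vanishes at 1, then shows that
      f L_n = n a L_n ([fL_ad_L0]), and ad (- a L_0) can be subtracted.
    - If f kills all the L_m, then f A = f (X + A) for all X.  Taking X with
      zeros 1 and rho shows that f A is proportional to A up to l, for A of
      the form I_j + I_k; hence f is a scalar on the I_r ([fI_scalar]).
    - If f kills the L_m and the I_r, one functional at
      L_1 - L_0 + I_(1/2) + l shows that f l = 0 ([fl_eq0]); and c is killed
      by all derivations. *)

Set Implicit Arguments.
Unset Strict Implicit.
Unset Printing Implicit Defensive.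

Import Order.TTheory GRing.Theory Num.Theory.
Local Open Scope ring_scope.

Section MirrorHeisenbergVirasoroDerivations.
Variable K : numFieldType.
Implicit Types (x y u v : mhv K) (w : mhv_index -> K) (b : mhv_index).
Implicit Types (m n k j : int) (rho : K).

Local Notation h := (@halfint K).
Local Notation L := (@mhvL K).
Local Notation I := (@mhvI K).

(** * Linear functionals and coefficients *)

Lemma mhv_linear_ext (V : lmodType K) (f g : {linear mhv K -> V}) :
  (forall b, f << b >> = g << b >>) -> f =1 g.
Proof.
move=> efg x; apply/eqP; rewrite -subr_eq0; apply/eqP.
apply: (freeg_linear_eq0 (f := fun x => f x - g x)) => [c y z|b].
  by rewrite [f _]linearP [g _]linearP /= scalerBr opprD addrACA.
by rewrite efg subrr.
Qed.

(** [w] lists the values of a linear functional on the basis. *)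
Definition pairing w x : K := fglift (w : _ -> K^o) x.

Lemma pairingU w b : pairing w << b >> = w b.
Proof. by rewrite /pairing liftU scale1r. Qed.

Lemma pairingL w m : pairing w (L m) = w (BL m). Proof. exact: pairingU. Qed.
Lemma pairingI w k : pairing w (I k) = w (BI k). Proof. exact: pairingU. Qed.
Lemma pairingc w : pairing w (mhvc K) = w Bc. Proof. exact: pairingU. Qed.
Lemma pairingl w : pairing w (mhvl K) = w Bl. Proof. exact: pairingU. Qed.

Fact pairing_linear w : linear (pairing w : mhv K -> K^o).
Proof. exact: fglift_linear. Qed.

HB.instance Definition _ w := GRing.isLinear.Build K (mhv K) K^o _
  (pairing w) (pairing_linear w).

Lemma pairingD w x y : pairing w (x + y) = pairing w x + pairing w y.
Proof. exact: raddfD. Qed.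

Lemma pairingN w x : pairing w (- x) = - pairing w x.
Proof. exact: raddfN. Qed.

Lemma pairingZ w c x : pairing w (c *: x) = c * pairing w x.
Proof. exact: linearZ. Qed.

Lemma pairing0 w : pairing w 0 = 0. Proof. exact: raddf0. Qed.

Definition pairingE :=
  (pairingD, pairingN, pairingZ, pairing0,
   pairingL, pairingI, pairingc, pairingl, pairingU).

Lemma pairing_dom w x : pairing w x = \sum_(b <- dom x) coeff b x * w b.
Proof.
rewrite -{1}(freeg_sumE x) raddf_sum; apply: eq_bigr => b _.
by rewrite /= /pairing liftU.
Qed.

Lemma pairing_congr w w' x :
  (forall b, coeff b x != 0 -> w b = w' b) -> pairing w x = pairing w' x.
Proof.
move=> eww; rewrite !pairing_dom; apply: eq_big_seq => b.
by rewrite mem_dom => /eww ->.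
Qed.

Lemma pairing_coeff b x : pairing (fun b' => (b' == b)%:R) x = coeff b x.
Proof. by []. Qed.

Lemma mhv_coeff_ext x y : (forall b, coeff b x = coeff b y) -> x = y.
Proof. by move=> exy; apply/eqP/freeg_eqP. Qed.

(** Keeps the eigenvalues of ad L_0 on the two families L and I apart. *)
Lemma halfint_neq_int k m : h k != m%:~R.
Proof.
apply/eqP=> /(congr1 (fun z => 2 * z)).
rewrite /halfint mulrDr divff ?pnatr_eq0 // => /eqP.
by rewrite -[2]/(2%:~R) -[1]/(1%:~R) -!rmorphM -rmorphD /= eqr_int; lia.
Qed.

Lemma halfint_neq0 k : h k != 0.
Proof. exact: (halfint_neq_int k 0). Qed.

Lemma halfint_inj : injective h.
Proof. by move=> k j /addIr /intr_inj. Qed.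

(** * The outer derivation delta *)

(** The factor 2 on l is forced by [I_r, I_s] being a multiple of l. *)
Definition mhv_delta x : mhv K :=
  fglift (fun b => match b with
                   | BI k => I k | Bl => 2 *: mhvl K | _ => 0 end) x.

Fact mhv_delta_linear : linear mhv_delta.
Proof. exact: fglift_linear. Qed.

HB.instance Definition _ := GRing.isLinear.Build K (mhv K) (mhv K) _
  mhv_delta mhv_delta_linear.

Lemma mhv_deltaD x y : mhv_delta (x + y) = mhv_delta x + mhv_delta y.
Proof. exact: raddfD. Qed.

Lemma mhv_delta0 : mhv_delta 0 = 0. Proof. exact: raddf0. Qed.

Lemma mhv_deltaN x : mhv_delta (- x) = - mhv_delta x.
Proof. exact: raddfN. Qed.

Lemma mhv_deltaZ c x : mhv_delta (c *: x) = c *: mhv_delta x.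
Proof. exact: linearZ. Qed.

Lemma mhv_deltaU b : mhv_delta << b >> =
  match b with BI k => I k | Bl => 2 *: mhvl K | _ => 0 end.
Proof. by rewrite /mhv_delta liftU scale1r. Qed.

Lemma mhv_deltaL m : mhv_delta (L m) = 0. Proof. exact: mhv_deltaU. Qed.
Lemma mhv_deltaI k : mhv_delta (I k) = I k. Proof. exact: mhv_deltaU. Qed.
Lemma mhv_deltac : mhv_delta (mhvc K) = 0. Proof. exact: mhv_deltaU. Qed.
Lemma mhv_deltal : mhv_delta (mhvl K) = 2 *: mhvl K.
Proof. exact: mhv_deltaU. Qed.

Definition mhv_deltaE :=
  (mhv_deltaD, mhv_deltaN, mhv_deltaZ, mhv_deltaL, mhv_deltaI,
   mhv_deltac, mhv_deltal).

Lemma mhv_bilinear_eq0 (F : mhv K -> mhv K -> mhv K) :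
  (forall y, linear (F^~ y)) -> (forall x, linear (F x)) ->
  (forall b b', F << b >> << b' >> = 0) -> forall x y, F x y = 0.
Proof.
move=> Fl Fr F0 x y; move: x; apply: freeg_linear_eq0 => // b.
by move: y; apply: freeg_linear_eq0.
Qed.

Lemma mhv_delta_derivation : derivation mhv_delta.
Proof.
suff E x y : mhv_delta (mhv_lie x y)
    - (mhv_lie (mhv_delta x) y + mhv_lie x (mhv_delta y)) = 0.
  by move=> x y; apply/eqP; rewrite -subr_eq0; apply/eqP/E.
have rearr c (u1 u2 u3 v1 v2 v3 : mhv K) :
    c *: u1 + v1 - (c *: u2 + v2 + (c *: u3 + v3)) =
    c *: (u1 - (u2 + u3)) + (v1 - (v2 + v3)).
  by have := lin_rearr c 1 u1 u2 u3 v1 v2 v3; rewrite !scale1r.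
move: x y; apply: mhv_bilinear_eq0 => [y c x z|x c y z|b b'].
  by rewrite !(mhv_lieDl, mhv_lieZl, mhv_deltaD, mhv_deltaZ) rearr.
  by rewrite !(mhv_lieDr, mhv_lieZr, mhv_deltaD, mhv_deltaZ) rearr.
rewrite !mhv_deltaU mhv_lieU.
case: b b' => [m|k||] [n|j||] /=;
  rewrite ?mhv_lie0r ?(mhv_lieC 0) ?mhv_lie0r ?mhv_lieZl ?mhv_lieZr ?mhv_lieU /=
    ?mhv_deltaE ?mhv_delta0 ?scaler0 ?oppr0 ?addr0 ?add0r ?oppr0 ?subrr //.
by rewrite scaler_nat mulr2n scalerDr subrr.
Qed.

(** * All derivations are inner up to multiples of delta *)

(** The eigenvalues of - ad L_0 on the basis. *)
Definition mhv_deg b : K :=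
  match b with BL m => m%:~R | BI k => h k | _ => 0 end.

Lemma mhv_lieL0U b : mhv_lie (L 0) << b >> = - mhv_deg b *: << b >>.
Proof.
rewrite mhv_lieU; case: b => [m|k||] /=; rewrite ?oppr0 ?scale0r //.
- rewrite !add0r !rmorphN /=; case: eqP => [->|_]; last by rewrite scale0r addr0.
  by rewrite expr0n /= addr0 mul0r scale0r addr0.
- by rewrite add0r.
Qed.

Lemma coeff_lieL0 b x : coeff b (mhv_lie (L 0) x) = - mhv_deg b * coeff b x.
Proof.
apply/eqP; rewrite -subr_eq0; apply/eqP; move: x.
apply: (@freeg_linear_eq0 K _ K^o) => [c y z|b'].
  rewrite mhv_lieDr mhv_lieZr !coeffD !coeffZ.
  by rewrite -[c *: _]/(c * _); ring.
rewrite mhv_lieL0U coeffZ coeffU.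
case: (b' =P b) => [->|]; by rewrite /= ?mulr1 ?mulr0 ?subrr.
Qed.

Lemma mhv_lieNl x y : mhv_lie (- x) y = - mhv_lie x y.
Proof. by rewrite -scaleN1r mhv_lieZl scaleN1r. Qed.

Lemma mhv_lieBl x y z : mhv_lie (x - y) z = mhv_lie x z - mhv_lie y z.
Proof. by rewrite mhv_lieDl mhv_lieNl. Qed.

Lemma mhv_lieNr x y : mhv_lie x (- y) = - mhv_lie x y.
Proof. exact: raddfN. Qed.

Lemma mhv_lieBr x y z : mhv_lie x (y - z) = mhv_lie x y - mhv_lie x z.
Proof. exact: raddfB. Qed.

Lemma mhv_lie0l x : mhv_lie 0 x = 0.
Proof. by rewrite mhv_lieC mhv_lie0r oppr0. Qed.

Lemma derivation_ad u : derivation (mhv_lie u).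
Proof.
suff E x y : mhv_lie u (mhv_lie x y) =
    mhv_lie (mhv_lie u x) y + mhv_lie x (mhv_lie u y) by exact: E.
apply/eqP; rewrite -subr_eq0 -[X in _ == X](mhv_lie_jacobi u x y).
by rewrite (mhv_lieC y u) (mhv_lieC y (mhv_lie u x)) mhv_lieNr opprD addrAC addrA.
Qed.

Lemma derivationB (D E : {linear mhv K -> mhv K}) :
  derivation D -> derivation E -> derivation (D \- E).
Proof.
move=> dD dE; suff H x y : D (mhv_lie x y) - E (mhv_lie x y) =
    mhv_lie (D x - E x) y + mhv_lie x (D y - E y) by exact: H.
by rewrite mhv_lieBl mhv_lieBr dD dE opprD addrACA.
Qed.

(** The components of nonzero degree of D L_0 are removed by an inner
    derivation, because ad L_0 is invertible on them. *)
Lemma ad_L0_onto v : exists u, forall b, mhv_deg b != 0 ->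
  coeff b (v - mhv_lie u (L 0)) = 0.
Proof.
pose w b : mhv K := (mhv_deg b)^-1 *: << b >>.
exists (fglift w v) => b b0; rewrite mhv_lieC opprK coeffD coeff_lieL0.
suff -> : coeff b (fglift w v) = (mhv_deg b)^-1 * coeff b v.
  by rewrite mulrA mulNr divff // mulN1r subrr.
apply/eqP; rewrite -subr_eq0; apply/eqP; move: v.
apply: (@freeg_linear_eq0 K _ K^o) => [c y z|b'].
  rewrite fglift_linear !coeffD !coeffZ.
  by rewrite -[c *: _]/(c * _); ring.
rewrite liftU scale1r coeffZ !coeffU mul1r.
case: (b' =P b) => [->|]; by rewrite ?mulr0 subrr.
Qed.

Lemma derivation_lie (D : {linear mhv K -> mhv K}) x y : derivation D ->
  D (mhv_lie x y) = mhv_lie (D x) y + mhv_lie x (D y).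
Proof. exact. Qed.

Lemma mhv_deg_eq0 b : mhv_deg b = 0 -> b = BL 0 \/ b = Bc \/ b = Bl.
Proof.
case: b => [m|k||] /=; [|by move/eqP; rewrite (negPf (halfint_neq0 _))|by auto|by auto].
by move/eqP; rewrite intr_eq0 => /eqP ->; auto.
Qed.

Lemma deg0_decomp x : (forall b, mhv_deg b != 0 -> coeff b x = 0) ->
  x = coeff (BL 0) x *: L 0 + coeff Bc x *: mhvc K + coeff Bl x *: mhvl K.
Proof.
move=> x0; apply: mhv_coeff_ext => b; rewrite !coeffD !coeffZ !coeffU !mul1r.
case: (mhv_deg b =P 0) => [/mhv_deg_eq0|/eqP b0].
  by case=> [->|[->|->]]; rewrite /= ?eqxx ?mulr1 ?mulr0 ?addr0 ?add0r.
have neq b' : mhv_deg b' = 0 -> b' == b = false.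
  by move=> e; apply: contraNF b0 => /eqP <-; rewrite e.
rewrite x0 // !neq //.
by rewrite !mulr0 !addr0.
Qed.

Lemma mhv_lie_deg0 x y : (forall b, mhv_deg b != 0 -> coeff b x = 0) ->
  mhv_lie x y = coeff (BL 0) x *: mhv_lie (L 0) y.
Proof.
move=> x0; rewrite {1}(deg0_decomp x0) !(mhv_lieDl, mhv_lieZl).
rewrite (@mhv_lie_centrall K Bc) ?(@mhv_lie_centrall K Bl); auto.
by rewrite !scaler0 !addr0.
Qed.

(** If D L_0 has degree 0, then D commutes with ad L_0 up to a multiple of
    ad L_0 itself, hence preserves degrees.  So D is diagonal on the basis
    outside of degree 0, and [L_m, I_k] makes its eigenvalues affine in the
    degree: D is a combination of ad L_0 and delta. *)
Section DegreeZero.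
Variable D : {linear mhv K -> mhv K}.
Hypothesis dD : derivation D.
Hypothesis D0 : forall b, mhv_deg b != 0 -> coeff b (D (L 0)) = 0.

Lemma deg0_coeff b b' : mhv_deg b' != mhv_deg b -> coeff b' (D << b >>) = 0.
Proof.
move=> bb'; have := derivation_lie (L 0) << b >> dD.
rewrite (mhv_lie_deg0 _ D0) mhv_lieL0U linearZ /= => /(congr1 (coeff b')).
rewrite coeffD !coeffZ coeff_lieL0 coeffU mul1r.
have /negPf -> : b != b' by apply: contraNneq bb' => ->.
rewrite !mulr0 add0r => /eqP; rewrite !mulNr eqr_opp -subr_eq0 -mulrBl mulf_eq0.
by rewrite subr_eq0 eq_sym (negPf bb') => /eqP.
Qed.

Let alpha m := coeff (BL m) (D (L m)).
Let beta k := coeff (BI k) (D (I k)).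

Lemma deg0_I k : D (I k) = beta k *: I k.
Proof.
apply: mhv_coeff_ext => b; rewrite coeffZ coeffU mul1r.
case: eqP => [<-|bk]; first by rewrite mulr1.
rewrite mulr0 deg0_coeff //; case: b bk => [m|j||] bk /=.
- by rewrite eq_sym halfint_neq_int.
- by apply/eqP => /halfint_inj jk; case: bk; rewrite jk.
- by rewrite eq_sym halfint_neq0.
- by rewrite eq_sym halfint_neq0.
Qed.

Lemma deg0_L m : m != 0 -> D (L m) = alpha m *: L m.
Proof.
move=> m0; apply: mhv_coeff_ext => b; rewrite coeffZ coeffU mul1r.
case: eqP => [<-|bk]; first by rewrite mulr1.
rewrite mulr0 deg0_coeff //; case: b bk => [n|j||] bk /=.
- by apply/eqP => /intr_inj jk; case: bk; rewrite jk.
- by rewrite halfint_neq_int.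
- by rewrite eq_sym intr_eq0.
- by rewrite eq_sym intr_eq0.
Qed.

(** The coefficient of [L_m, I_k] is the nonzero half-integer - (k + 1/2), so
    the eigenvalues add up for all m, including m = 0. *)
Lemma deg0_LI m k : beta (m + k) = alpha m + beta k.
Proof.
have hk := halfint_neq0 k.
have := derivation_lie (L m) (I k) dD.
have -> : mhv_lie (D (L m)) (I k) = alpha m *: mhv_lie (L m) (I k).
  have [->|m0] := eqVneq m 0; first exact: mhv_lie_deg0.
  by rewrite deg0_L // mhv_lieZl.
rewrite deg0_I mhv_lieZr -scalerDl [mhv_lie _ _]lieLI linearZ /= deg0_I.
rewrite !scalerA => /(congr1 (coeff (BI (m + k)))).
rewrite !coeffZ coeffU eqxx !mulr1 mulrC => /mulIf; apply.
by rewrite oppr_eq0.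
Qed.

Lemma deg0_beta k : beta k = beta 0 + k%:~R * alpha 1.
Proof.
elim/int_rect: k => [|k IH|k IH]; first by rewrite mul0r addr0.
- rewrite -addn1 PoszD addrC deg0_LI IH rmorphD /= mulrDl mul1r.
  by rewrite addrCA [alpha 1 + _]addrC.
- have := deg0_LI 1 (- k.+1%:Z); rewrite (_ : 1 + - k.+1%:Z = - k%:Z); last by lia.
  rewrite IH => e; rewrite -[LHS](addKr (alpha 1)) -e.
  by rewrite -addn1 PoszD !rmorphN rmorphD /=; ring.
Qed.

Lemma deg0_alpha m : alpha m = m%:~R * alpha 1.
Proof.
apply: (addIr (beta 0)); rewrite -deg0_LI addr0 deg0_beta addrC; congr (_ + _).
Qed.

Lemma deg0_derivationP :
  exists u lam, forall x, D x = mhv_lie u x + lam *: mhv_delta x.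
Proof.
pose lam := beta 0 - alpha 1 / 2.
(* L_0, c and l are recovered from brackets of vectors of nonzero degree. *)
have DL0 : D (L 0) = 0.
  have := derivation_lie (L 1) (L (-1)) dD.
  rewrite (@deg0_L 1) // (@deg0_L (-1)) // mhv_lieZl mhv_lieZr -scalerDl.
  rewrite (deg0_alpha (-1)) mulN1r subrr scale0r.
  rewrite [mhv_lie _ _]lieLL subrr eqxx expr1n subrr mul0r scale0r addr0.
  rewrite linearZ /= => /eqP.
  by rewrite scaler_eq0 intr_eq0 => /eqP.
have Dc : D (mhvc K) = 0.
  have := derivation_lie (L 2) (L (-2)) dD.
  rewrite (@deg0_L 2) // (@deg0_L (-2)) // mhv_lieZl mhv_lieZr -scalerDl.
  rewrite (deg0_alpha (-2)) (deg0_alpha 2) rmorphN mulNr subrr scale0r.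
  rewrite [mhv_lie _ _]lieLL subrr eqxx.
  rewrite linearD !linearZ /= DL0 scaler0 add0r => /eqP.
  rewrite scaler_eq0 => /orP[|/eqP//].
  rewrite (_ : (_ / _) = 2^-1); first by rewrite invr_eq0 pnatr_eq0.
  by field.
have Dl : D (mhvl K) = (2 * lam) *: mhvl K.
  have := derivation_lie (I 0) (I (-1)) dD.
  rewrite !deg0_I mhv_lieZl mhv_lieZr -scalerDl (deg0_beta (-1)).
  rewrite [mhv_lie _ _]lieII eqxx /halfint add0r scalerA linearZ /=.
  move/(congr1 (fun z => 2 *: z)); rewrite !scalerA divff ?pnatr_eq0 // scale1r => ->.
  by congr (_ *: _); rewrite /lam; field.
exists (- alpha 1 *: L 0), lam => x.
pose E : {linear mhv K -> mhv K} :=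
  mhv_lie (- alpha 1 *: L 0) \+ (lam \*: mhv_delta).
rewrite -[RHS]/(E x); apply: mhv_linear_ext => b.
rewrite /E /= mhv_lieZl mhv_lieL0U mhv_deltaU.
case: b => [m|k||] /=.
- have [->|m0] := eqVneq m 0; first by rewrite DL0 oppr0 scale0r !scaler0 addr0.
  by rewrite deg0_L // deg0_alpha scaler0 addr0 scalerA mulrNN mulrC.
- rewrite deg0_I deg0_beta scalerA -scalerDl; congr (_ *: _).
  by rewrite /lam /halfint; field.
- by rewrite Dc oppr0 scale0r !scaler0 addr0.
- by rewrite Dl oppr0 scale0r scaler0 add0r scalerA mulrC.
Qed.

End DegreeZero.

Lemma derivationP (D : {linear mhv K -> mhv K}) : derivation D ->
  exists u lam, forall x, D x = mhv_lie u x + lam *: mhv_delta x.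
Proof.
move=> dD; have [u uP] := ad_L0_onto (D (L 0)).
have [v [lam E]] := deg0_derivationP (derivationB dD (derivation_ad u)) uP.
exists (v + u), lam => x; rewrite mhv_lieDl addrAC -E /=.
by rewrite subrK.
Qed.

(** * Functionals that constrain local derivations *)

Lemma pairing_linearl w1 w2 c1 c2 x :
  pairing (fun b => c1 * w1 b + c2 * w2 b) x =
  c1 * pairing w1 x + c2 * pairing w2 x.
Proof.
rewrite !pairing_dom !mulr_sumr -big_split /=; apply: eq_bigr => b _.
by rewrite mulrDr !(mulrCA (coeff b x)).
Qed.

(** The positive integers are infinitely many nonzero roots. *)
Lemma poly_eq0_nonzero_roots (p : {poly K}) :
  (forall rho, rho != 0 -> p.[rho] = 0) -> p = 0.
Proof.
move=> p0; apply/eqP; apply: contraT => pn0.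
have := max_poly_roots pn0 (rs := [seq i.+1%:R | i <- iota 0 (size p)]).
rewrite size_map size_iota ltnn; apply.
  by apply/allP => _ /mapP[i _ ->]; rewrite /root p0 ?pnatr_eq0.
by rewrite map_inj_uniq ?iota_uniq // => i j /eqP; rewrite eqr_nat => /eqP[].
Qed.

(** Laurent polynomials that vanish at all nonzero points are zero.  The
    exponents [e] need to separate only the basis vectors of nonzero weight
    [a], so that one family, L or I, can be selected. *)
Lemma laurent_eq0 (e : mhv_index -> int) (a : mhv_index -> K) x :
  (forall rho, rho != 0 -> pairing (fun b => a b * rho ^ e b) x = 0) ->
  forall b, a b != 0 -> (forall b', a b' != 0 -> e b' = e b -> b' = b) ->
  coeff b x = 0.
Proof.
move=> x0 b ab0 injb; have [bx|/coeff_outdom//] := boolP (b \in dom x).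
have [N eN] : exists N : nat, forall b', b' \in dom x -> 0 <= e b' + N%:Z.
  exists (\sum_(b' <- dom x) `|e b'|)%N => b' b'x.
  by rewrite (bigD1_seq b') ?uniq_dom //=; lia.
pose p := \sum_(b' <- dom x) (coeff b' x * a b') *: 'X^(`|e b' + N%:Z|).
have p0 : p = 0.
  apply: poly_eq0_nonzero_roots => rho rho0.
  transitivity (rho ^ N%:Z * pairing (fun b => a b * rho ^ e b) x).
    rewrite /p horner_sum pairing_dom mulr_sumr; apply: eq_big_seq => b' b'x.
    rewrite hornerZ hornerXn.
    have -> : rho ^+ `|e b' + N%:Z| = rho ^ e b' * rho ^ N%:Z.
      rewrite -expfzDr // -[in RHS](gez0_abs (eN _ b'x)). exact: exprnP.
    by rewrite mulrA [RHS]mulrC mulrA.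
  by rewrite x0 // mulr0.
have := congr1 (fun q : {poly K} => q`_(`|e b + N%:Z|)) p0.
rewrite /p coef0 coef_sum (bigD1_seq b) ?uniq_dom //= big_seq_cond big1.
  rewrite addr0 coefZ coefXn eqxx mulr1 => /eqP.
  by rewrite mulf_eq0 (negPf ab0) orbF => /eqP.
move=> b' /andP[b'x b'b]; rewrite coefZ coefXn.
have [->|ab'0] := eqVneq (a b') 0; first by rewrite mulr0 mul0r.
case: eqP => [E|_]; last by rewrite mulr0.
have /(injb _ ab'0) eb : e b' = e b by have := eN _ bx; have := eN _ b'x; lia.
by rewrite eb eqxx in b'b.
Qed.

(** Local derivations in explicit form: unlike the definition with arbitrary
    derivations, this one is visibly stable under subtraction of ad v and
    delta. *)
Definition pointwise_derivation (f : mhv K -> mhv K) :=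
  forall x, exists u lam, f x = mhv_lie u x + lam *: mhv_delta x.

(** The duality at the heart of the proof: a functional orthogonal to
    [g, x] and delta x also kills f x, whatever u and lam are at x. *)
Lemma pointwise_pairing f w x : pointwise_derivation f ->
  (forall b, pairing w (mhv_lie << b >> x) = 0) ->
  pairing w (mhv_delta x) = 0 -> pairing w (f x) = 0.
Proof.
move=> lf wx wd; have [u [lam ->]] := lf x.
rewrite pairingD pairingZ wd mulr0 addr0; move: u.
apply: (@freeg_linear_eq0 K _ K^o) => // c y z.
by rewrite mhv_lie_linearl pairingD pairingZ.
Qed.

Lemma pointwise_sub f v mu : pointwise_derivation f ->
  pointwise_derivation (fun x => f x - (mhv_lie v x + mu *: mhv_delta x)).
Proof.
move=> lf x; have [u [lam ->]] := lf x; exists (u - v), (lam - mu).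
by rewrite mhv_lieBl scalerBl opprD addrACA.
Qed.

Lemma pointwise_c f : pointwise_derivation f -> f (mhvc K) = 0.
Proof.
move=> lf; have [u [lam ->]] := lf (mhvc K).
by rewrite mhv_deltac scaler0 addr0 mhv_lieC mhv_lie_centrall ?oppr0; auto.
Qed.

Lemma pointwise_l f : pointwise_derivation f ->
  f (mhvl K) = coeff Bl (f (mhvl K)) *: mhvl K.
Proof.
move=> lf; have [u [lam ->]] := lf (mhvl K).
rewrite mhv_deltal mhv_lieC mhv_lie_centrall ?oppr0 ?add0r; auto.
by rewrite scalerA coeffZ coeffU eqxx !mulr1.
Qed.

Definition weightL (a : int -> K) b : K := if b is BL m then a m else 0.
Definition weightI (a : int -> K) b : K := if b is BI m then a m else 0.

(** Expands the bracket of a basis vector with an explicit element, and then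
    the value of a functional on the result. *)
Ltac brackets := rewrite ?(mhv_lieDr, mhv_lieNr, mhv_lieZr) ?mhv_lieU /=
  ?pairingE /= ?mhv_lie0r ?(mul0r, mulr0, addr0, add0r, subr0, oppr0).

(** * Local derivations that vanish on L_0 *)

Section KillL0.
Variable f : {linear mhv K -> mhv K}.
Hypothesis lf : pointwise_derivation f.
Hypothesis fL0 : f (L 0) = 0.

(** The parameter c is free since f kills L_0: a vector field with a zero at
    any chosen point can be used for the same value f L_m. *)
Lemma pairing_fL (w : mhv_index -> K) m c :
  (forall b, pairing w (mhv_lie << b >> (L m - c *: L 0)) = 0) ->
  pairing w (f (L m)) = 0.
Proof.
move=> wm; rewrite -[f _]subr0 -[X in _ - X](scaler0 _ c) -fL0 -linearZ -linearB.
apply: pointwise_pairing => //.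
by rewrite linearB linearZ /= !mhv_deltaL scaler0 subr0 pairing0.
Qed.

(** X = z^m - rho^m vanishes at rho and there T^2 X = m T X.  Hence T Y - m Y
    vanishes at rho for each Y = U TX - X TU; its coefficients are n - m. *)
Lemma coeff_fL_L m n : n != m -> coeff (BL n) (f (L m)) = 0.
Proof.
move=> nm; pose a b := weightL (fun n => (n - m)%:~R) b.
pose e b := if b is BL n then n else 0.
apply: (@laurent_eq0 e a); last 2 first.
- by rewrite /a /= intr_eq0 subr_eq0.
- by case=> [n'|j||] /=; rewrite ?eqxx // => _ ->.
move=> rho rho0; apply: (@pairing_fL _ m (rho ^ m)) => -[k|j||];
  rewrite /a /e /=; brackets => //.
rewrite expfzDr //.
by rewrite !(rmorphB, rmorphD) /=; ring.
Qed.

(** The function part of [u, x] is a multiple of X, so it vanishes at rho. *)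
Lemma coeff_fL_I m n : coeff (BI n) (f (L m)) = 0.
Proof.
pose a b := weightI (fun=> 1) b.
pose e b := if b is BI n then n else 0.
apply: (@laurent_eq0 e a); last 2 first.
- exact: oner_neq0.
- by case=> [n'|j||] /=; rewrite ?eqxx // => _ ->.
move=> rho rho0; apply: (@pairing_fL _ m (rho ^ m)) => -[k|j||];
  rewrite /a /e /=; brackets => //.
by rewrite expfzDr //; ring.
Qed.

Lemma coeff_fL_l m : coeff Bl (f (L m)) = 0.
Proof.
rewrite -[LHS]/(pairing (fun b => (b == Bl)%:R) (f (L m))).
by apply: (@pairing_fL _ m 0) => -[k|j||] /=; brackets.
Qed.

(** In [g, L_m], c appears only next to L_0, in [L_(-m), L_m], with a fixed
    ratio: this gives a functional on L_0 and c that kills [g, L_m]. *)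
Lemma coeff_fL_c m : coeff Bc (f (L m)) = 0.
Proof.
have [->|m0] := eqVneq m 0; first by rewrite fL0 coeff0.
pose w b : K :=
  if b is BL n then if n == 0 then - (m%:~R ^+ 2 - 1) / 24 else 0
  else (b == Bc)%:R.
have : pairing w (f (L m)) = 0.
  apply: (@pairing_fL _ m 0) => -[k|j||] /=; brackets => //.
  case: eqP => km0; last by rewrite !mul0r !mulr0 addr0.
  have -> : k = - m by lia.
  by rewrite !(rmorphB, rmorphN) /=; field.
rewrite (pairing_congr (w' := fun b => (b == Bc)%:R)) ?pairing_coeff //.
case=> [n|j||] //= fn; case: eqP => // n0.
by rewrite coeff_fL_L ?eqxx // n0 eq_sym in fn.
Qed.

Lemma fL_diagonal m : f (L m) = coeff (BL m) (f (L m)) *: L m.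
Proof.
apply: mhv_coeff_ext => b; rewrite coeffZ coeffU mul1r.
case: eqP => [<-|mb]; first by rewrite mulr1.
rewrite mulr0; case: b mb => [n|j||] mb.
- by apply: coeff_fL_L; apply/eqP => nm; apply: mb; rewrite nm.
- exact: coeff_fL_I.
- exact: coeff_fL_c.
- exact: coeff_fL_l.
Qed.

(** X = z + z^n - 2 vanishes at 1, so Y T^2 X - TY TX vanishes at 1 for each
    Y = U TX - X TU.  On Y = a_1 z + a_n z^n this reads
    (n - 1) (a_n - n a_1) = 0, up to sign. *)
Lemma fL_ad_L0 n : f (L n) = (n%:~R * coeff (BL 1) (f (L 1))) *: L n.
Proof.
have [->|n1] := eqVneq n 1; first by rewrite mul1r -fL_diagonal.
pose w := weightL (fun k => 1 + n%:~R ^+ 2 - k%:~R * (1 + n%:~R)).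
have : pairing w (f (L 1 + L n - 2 *: L 0)) = 0.
  apply: pointwise_pairing => // [[k|j||]|]; rewrite /w; brackets => //.
  - by rewrite !(rmorphB, rmorphD) /=; ring.
  - by rewrite !mhv_deltaE scaler0 oppr0 !addr0 pairing0.
rewrite (_ : f _ = f (L 1) + f (L n)); last first.
  by rewrite linearB linearD linearZ /= fL0 scaler0 subr0.
rewrite [f (L n)]fL_diagonal; set a1 := coeff _ (f (L 1)); set an := coeff _ (f (L n)).
rewrite fL_diagonal -/a1 /w; brackets => e; congr (_ *: _).
have n10 : (n%:~R - 1 : K) != 0 by rewrite subr_eq0 -[1]/(1%:~R) eqr_int.
apply: (mulfI n10); apply/eqP; rewrite -subr_eq0 -[X in _ == X]oppr0 -e; apply/eqP.
by ring.
Qed.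
End KillL0.

(** * Local derivations that vanish on all the L_m *)

Section KillL.
Variable f : {linear mhv K -> mhv K}.
Hypothesis lf : pointwise_derivation f.
Hypothesis fL : forall m, f (L m) = 0.

(** [g, I_k] and delta I_k have components along I and l only. *)
Lemma pairing_fI_LC k w :
  (forall n, w (BI n) = 0) -> w Bl = 0 -> pairing w (f (I k)) = 0.
Proof.
move=> wI0 wl0; apply: pointwise_pairing => // [[n|n||]|].
all: by rewrite ?mhv_deltaE; brackets; rewrite ?wI0 ?wl0 ?mulr0 //.
Qed.

Lemma coeff_fI_L k n : coeff (BL n) (f (I k)) = 0.
Proof. by rewrite -pairing_coeff pairing_fI_LC. Qed.

Lemma coeff_fI_c k : coeff Bc (f (I k)) = 0.
Proof. by rewrite -pairing_coeff pairing_fI_LC. Qed.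

(** The value at [rho] of the function part, with z^(1/2) factored out. *)
Local Notation ev rho := (pairing (weightI (fun n => rho ^ n))).

(** Let X = (z - 1) (z - rho) and A = z^j + z^k.  At a zero s of X, the
    function part of [u, X + A] + lam delta (X + A) is lam A(s) plus a multiple
    of U(s), and its vector field part is a multiple of U(s) as well.
    Eliminating U(1), U(rho) and lam leaves a functional that, on f A, compares
    the values at 1 and rho.  Since A(1) = 2, f A is proportional to A. *)
Lemma ev_fI_pair j k rho : rho != 0 ->
  2 * ev rho (f (I j + I k)) = ev 1 (f (I j + I k)) * ev rho (I j + I k).
Proof.
move=> rho0; have [->|rho1] := eqVneq rho 1.
  by rewrite [in RHS]pairingD !pairingI /= !exp1rz mulrC.
(* a and c weigh the values at 1 and rho of the vector field part, so as to
   cancel U(1) and U(rho); X has derivatives 1 - rho and rho (rho - 1). *)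
pose A := rho ^ j + rho ^ k; pose A' := h j * rho ^ j + h k * rho ^ k.
pose a := A * (h j + h k) / (1 - rho).
pose c := - 2 * A' / (rho * (rho - 1)).
pose w b : K := match b with
  | BL n => a + c * rho ^ n | BI n => 2 * rho ^ n - A | _ => 0 end.
pose x := L 2 - (1 + rho) *: L 1 + rho *: L 0.
have fx : f (x + (I j + I k)) = f (I j + I k).
  have fLc d m : f (d *: L m) = 0 by rewrite linearZ /= fL scaler0.
  by rewrite [LHS]linearD [f x]linearD [f (_ - _)]linearB !fLc fL subr0 !add0r.
have s0 : rho - 1 != 0 by rewrite subr_eq0.
have s1 : 1 - rho != 0 by rewrite subr_eq0 eq_sym.
have r1 : rho ^ 1 = rho by rewrite expr1z.
have : pairing w (f (x + (I j + I k))) = 0.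
  apply: pointwise_pairing => // [[n|n||]|]; rewrite /x; brackets => //.
  - rewrite /w !expfzDr // !rmorphB /= r1 /a /c /A /A'.
    by field; rewrite ?s0 ?s1 ?rho0.
  - rewrite /w !expfzDr // r1.
    by ring.
  - by rewrite !mhv_deltaE !scaler0 subr0 !add0r !pairingE /w /A /=; ring.
rewrite fx (pairing_congr (w' := fun b =>
  2 * weightI (fun n => rho ^ n) b + (- A) * weightI (fun n => 1 ^ n) b)).
  rewrite pairing_linearl mulNr => /eqP; rewrite subr_eq0 => /eqP ->.
  by rewrite [in RHS]pairingD !pairingI mulrC.
case=> [n|n||] /=; last 3 first.
- by rewrite exp1rz mulr1.
- by rewrite !mulr0 addr0.
- by rewrite !mulr0 addr0.
by rewrite linearD /= coeffD !coeff_fI_L addr0 eqxx.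
Qed.

Lemma coeff_fI_pair j k n : 2 * coeff (BI n) (f (I j + I k)) =
  ev 1 (f (I j + I k)) * coeff (BI n) (I j + I k).
Proof.
apply/eqP; rewrite -subr_eq0 -!coeffZ -coeffB; apply/eqP.
apply: (@laurent_eq0 (fun b => if b is BI m then m else 0) (weightI (fun=> 1))).
- move=> rho rho0; rewrite (pairing_congr (w' := weightI (fun n => rho ^ n))).
    by rewrite pairingD pairingN !pairingZ ev_fI_pair // subrr.
  by case=> [m|m||] _ /=; rewrite ?mul0r ?mul1r.
- exact: oner_neq0.
- by case=> [m|m||] /=; rewrite ?eqxx // => _ ->.
Qed.

Let beta k := coeff (BI k) (f (I k)).

(** The case j = k of the proportionality. *)
Lemma coeff_fI_I k n : n != k -> coeff (BI n) (f (I k)) = 0.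
Proof.
move=> nk; have := coeff_fI_pair k k n; rewrite linearD /= !coeffD coeffU.
rewrite (_ : _ == _ = false); last by apply: contraNF nk => /eqP [->].
rewrite mulr0 addr0 mulr0 => /eqP.
by rewrite mulf_eq0 pnatr_eq0 -mulr2n mulrn_eq0 /= => /eqP.
Qed.

(** I_j and I_k are eigenvectors, and so is I_j + I_k by the proportionality:
    the eigenvalues agree. *)
Lemma fI_coeff_const j k : beta j = beta k.
Proof.
have [->//|jk] := eqVneq j k.
have kj : k != j by rewrite eq_sym.
have neq m n : m != n -> BI m == BI n = false.
  by move=> mn; apply: contraNF mn => /eqP [->].
have := coeff_fI_pair j k j; have := coeff_fI_pair j k k.
rewrite linearD /= !coeffD !coeffU !eqxx (neq _ _ jk) (neq _ _ kj).
rewrite (coeff_fI_I jk) (coeff_fI_I kj) !mulr0 !add0r !addr0 => <-.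
by move/mulfI; apply; rewrite pnatr_eq0.
Qed.

(** In [g, L_0 + I_r], l comes from I_(-r), whose bracket with L_0 also gives
    I_(-r); the latter arises otherwise only from L_(-2r), which in turn gives
    L_(-2r).  The functional cancels these three contributions. *)
Lemma coeff_fI_l k : coeff Bl (f (I k)) = 0.
Proof.
(* With r = k + 1/2, I_(-r) has index - k - 1 and L_(-2r) has index - 2k - 1. *)
pose k' := - k - 1.
pose w b : K := match b with
  | BL n => if n == k' - k then 2^-1 else 0
  | BI n => if n == k' then -1 else 0
  | Bl => 1 | Bc => 0 end.
have : pairing w (f (L 0 + I k)) = 0.
  apply: pointwise_pairing => // [[n|n||]|]; brackets => //.
  - rewrite /w /=.
    case: eqP => e1; case: eqP => e2; try lia; rewrite ?mulr0 ?addr0 //.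
    by have -> : n = k' - k by []; rewrite /k' /halfint; field.
  - rewrite /w addrC.
    case: eqP => e1; case: eqP => e2; try lia; rewrite ?mulr0 ?addr0 ?mul0r //; ring.
  - by rewrite !mhv_deltaE add0r pairingI /w; case: eqP => // e; lia.
rewrite linearD /= fL add0r.
rewrite (pairing_congr (w' := fun b => (b == Bl)%:R)) ?pairing_coeff //.
case=> [n|n||] //= nz; first by rewrite coeff_fI_L eqxx in nz.
case: eqP => // e; rewrite coeff_fI_I ?eqxx // in nz.
by apply/eqP => nk; lia.
Qed.

Lemma fI_scalar : exists lam, forall k, f (I k) = lam *: I k.
Proof.
exists (beta 0) => k; apply: mhv_coeff_ext => b; rewrite coeffZ coeffU mul1r.
rewrite (fI_coeff_const 0 k); case: eqP => [<-|kb]; first by rewrite mulr1.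
rewrite mulr0; case: b kb => [n|n||] kb.
- exact: coeff_fI_L.
- by apply: coeff_fI_I; apply/eqP => nk; apply: kb; rewrite nk.
- exact: coeff_fI_c.
- exact: coeff_fI_l.
Qed.

End KillL.

(** If f x = mu l at x = X + A + l with X = z - 1 and A = z^(1/2), then lam = 0
    as A(1) is not 0, and u is proportional to X + A up to the center, hence
    mu = 0.  The functional below is dual to this computation: it is constant
    on each half of the two gradings; its values on the I_r are fixed by the
    condition on delta x and by [I_(-1/2), I_(1/2)], those on the L_n by
    [L_n, I_(1/2)]. *)
Lemma fl_eq0 (f : {linear mhv K -> mhv K}) : pointwise_derivation f ->
  (forall m, f (L m) = 0) -> (forall k, f (I k) = 0) -> f (mhvl K) = 0.
Proof.
move=> lf fL fI.
pose w b : K := match b with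
  | BL n => if 0 < n then 1 else 2^-1
  | BI n => if 0 <= n then -2 else -1
  | Bl => 1 | Bc => 0 end.
have : pairing w (f (L 1 - L 0 + I 0 + mhvl K)) = 0.
  apply: pointwise_pairing => // [[n|n||]|]; brackets => //.
  - rewrite /w /halfint rmorphB /=.
    have [->|n0] := eqVneq n 0; first by rewrite /=; field.
    have [->|n1] := eqVneq n 1; first by rewrite /=; field.
    by case: ltP => e1; case: ltP => e2; case: leP => e3; try lia; field.
  - rewrite /w; have [->|n1] := eqVneq n (-1).
      by rewrite /= /halfint; field.
    have -> : (n + 1 == 0) = false by apply/eqP; lia.
    by case: leP => e1; case: leP => e2; try lia; ring.
  - by rewrite !mhv_deltaE subr0 !add0r !pairingE /w /=; ring.
rewrite (_ : f _ = f (mhvl K)).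
  by rewrite (pointwise_l lf) !pairingE /w mulr1 => ->; rewrite scale0r.
by rewrite [LHS]linearD [f (_ + I 0)]linearD [f (_ - _)]linearB /= !fL fI subr0 !add0r.
Qed.

Lemma pointwise_derivation_global (f : {linear mhv K -> mhv K}) :
  pointwise_derivation f ->
  exists u lam, forall x, f x = mhv_lie u x + lam *: mhv_delta x.
Proof.
pose E u lam : {linear mhv K -> mhv K} := mhv_lie u \+ (lam \*: mhv_delta).
have sub (g : {linear mhv K -> mhv K}) u lam : pointwise_derivation g ->
    pointwise_derivation (g \- E u lam).
  exact: pointwise_sub.
move=> lf; have [u1 [lam1 fL0]] := lf (L 0).
pose f1 : {linear mhv K -> mhv K} := f \- E u1 lam1.
have lf1 : pointwise_derivation f1 by exact: sub.
have f1L0 : f1 (L 0) = 0.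
  by rewrite -[LHS]/(f (L 0) - (mhv_lie u1 (L 0) + lam1 *: mhv_delta (L 0))) -fL0 subrr.
have [a f1L] : exists a, forall n, f1 (L n) = (n%:~R * a) *: L n.
  by exists (coeff (BL 1) (f1 (L 1))); exact: fL_ad_L0.
pose f2 : {linear mhv K -> mhv K} := f1 \- E (- a *: L 0) 0.
have lf2 : pointwise_derivation f2 by exact: sub.
have f2E x : f2 x = f1 x + a *: mhv_lie (L 0) x.
  rewrite -[LHS]/(f1 x - (mhv_lie (- a *: L 0) x + 0 *: mhv_delta x)).
  by rewrite scale0r addr0 mhv_lieZl scaleNr opprK.
have f2L n : f2 (L n) = 0.
  by rewrite f2E f1L mhv_lieL0U scalerA -scalerDl mulrN mulrC subrr scale0r.
have [lam f2I] := fI_scalar lf2 f2L.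
pose f3 : {linear mhv K -> mhv K} := f2 \- E 0 lam.
have lf3 : pointwise_derivation f3 by exact: sub.
have f3E x : f3 x = f2 x - lam *: mhv_delta x.
  rewrite -[LHS]/(f2 x - (mhv_lie 0 x + lam *: mhv_delta x)).
  by rewrite mhv_lie0l add0r.
have f3L n : f3 (L n) = 0 by rewrite f3E f2L mhv_deltaL scaler0 subr0.
have f3I k : f3 (I k) = 0 by rewrite f3E f2I mhv_deltaI subrr.
have f30 x : f3 x = 0.
  move: x; apply: freeg_linear_eq0 => [|[n|k||]].
  - exact: linearP.
  - exact: f3L.
  - exact: f3I.
  - exact: pointwise_c.
  - exact: fl_eq0.
exists (u1 - a *: L 0), (lam1 + lam) => x.
have := f30 x; rewrite f3E f2E => /eqP; rewrite subr_eq0 => /eqP e.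
rewrite mhv_lieBl mhv_lieZl scalerDl -e.
rewrite -[f1 x]/(f x - (mhv_lie u1 x + lam1 *: mhv_delta x)).
rewrite [RHS]addrA (addrAC (mhv_lie u1 x)) [f x - _ + _]addrC.
by rewrite [RHS]addrA subrK [RHS]addrC subrK.
Qed.

Lemma local_derivation_is_derivation (f : {linear mhv K -> mhv K}) :
  local_derivation f -> derivation f.
Proof.
move=> lf; have pf : pointwise_derivation f.
  move=> x; have [D [dD ->]] := lf x.
  by have [u [lam E]] := derivationP dD; exists u, lam.
have [u [lam E]] := pointwise_derivation_global pf.
suff fD x y : f (mhv_lie x y) = mhv_lie (f x) y + mhv_lie x (f y) by exact: fD.
rewrite !E !(mhv_lieDl, mhv_lieDr, mhv_lieZl, mhv_lieZr).
rewrite (derivation_lie _ _ (derivation_ad u)).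
rewrite (derivation_lie _ _ mhv_delta_derivation) scalerDr.
exact: addrACA.
Qed.

End MirrorHeisenbergVirasoroDerivations.

Theorem theorem1p4 (R : realType) (f : {linear mhv R[i] -> mhv R[i]}) :
  local_derivation f -> derivation f.
Proof. exact: local_derivation_is_derivation. Qed.
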